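(* Let $n\ge2$, $a\in\mathbb{C}$, and $\lambda_1,\dots,\lambda_n\in\mathbb{C}^*$. Then the $\mathfrak{sl}_{n+1}(\mathbb{C})$-module $\Omega_{1-a}(\lambda_1,\dots,\lambda_n)$ is irreducible if and only if $a\notin-\frac{1}{n+1}\mathbb{Z}_+$.
   Context: $\mathbb{Z}_+$ denotes the non-negative integers. Let $\partial_i=t_i\frac{\partial}{\partial t_i}$ ($1\le i\le n$) on $\mathbb{C}[t_1^{\pm1},\dots,t_n^{\pm1}]$; for $u\in\mathbb{C}^n$, $j\in\mathbb{Z}^n$ put $D(u,j)=t_1^{j_1}\cdots t_n^{j_n}\sum_i u_i\partial_i$ and $(u|j)=\sum_i u_ij_i$. The Witt algebra $\mathcal{W}_n$ is the Lie algebra of derivations of $\mathbb{C}[t_1^{\pm1},\dots,t_n^{\pm1}]$, spanned by all $D(u,j)$. Embedding of $\mathfrak{sl}_{n+1}(\mathbb{C})$ in $\mathcal{W}_n$: put $e_{ij}=t_it_j^{-1}\partial_j$ ($1\le i,j\le n$), $e_{i,n+1}=-t_i\sum_{j=1}^n\partial_j$, $e_{n+1,i}=t_i^{-1}\partial_i$ ($1\le i\le n$), $e_{n+1,n+1}=-\sum_{j=1}^n\partial_j$. Then $\{e_{ij}:1\le i\ne j\le n+1\}\cup\{e_{ii}-e_{i+1,i+1}:1\le i\le n\}$ is the standard basis of $\mathfrak{sl}_{n+1}(\mathbb{C})\subset\mathcal{W}_n$. The module $\Omega_{1-a}(\lambda_1,\dots,\lambda_n)$ ($a\in\mathbb{C}$,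 $\lambda_i\in\mathbb{C}^*$): its underlying space is the polynomial algebra $\mathbb{C}[\partial_1,\dots,\partial_n]$ in commuting indeterminates, with $\mathcal{W}_n$ acting by $$D(u,j)\circ f(\partial_1,\dots,\partial_n)=\lambda_1^{j_1}\cdots\lambda_n^{j_n}\Big(\sum_{i=1}^nu_i\partial_i-a(u|j)\Big)f(\partial_1-j_1,\dots,\partial_n-j_n),$$ and it is regarded as an $\mathfrak{sl}_{n+1}(\mathbb{C})$-module by restriction. *)

(* Defs.v *)
(* The complex numbers are R[i], for R : realType; the definitions below make
   sense over any field C. *)
From HB Require Import structures.
From mathcomp Require Import all_boot all_order all_algebra.
From mathcomp Require Import freeg mpoly.
From mathcomp Require Import complex.
From mathcomp Require Import reals.
From mathcomp Require Import ring.

Set Implicit Arguments.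
Unset Strict Implicit.
Unset Printing Implicit Defensive.

Import GRing.Theory.
Local Open Scope ring_scope.

Lemma lin0 (C : nzRingType) (U V : lmodType C) (F : U -> V) :
  linear F -> F 0 = 0.
Proof.
move=> linF; have := linF 1 0 0; rewrite scaler0 addr0 scale1r => /eqP.
by rewrite -subr_eq0 opprD addrA subrr sub0r oppr_eq0 => /eqP.
Qed.

Section LinearExtension.
Context (C : comNzRingType) (K : choiceType).

Lemma fgliftEw (V : lmodType C) (F : K -> V) (d : seq K) x :
  uniq d -> {subset dom x <= d} ->
  fglift F x = \sum_(k <- d) coeff k x *: F k.
Proof.
move=> d_uniq le_xd.
rewrite -{1}(Freeg_dom x) fglift_Freeg /prelift big_map /=.
rewrite [RHS](bigID (mem (dom x))) /= [X in _ + X]big1 ?addr0; last first.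
  by move=> k /coeff_outdom ->; rewrite scale0r.
rewrite -[RHS]big_filter; apply: perm_big; apply: uniq_perm => [||k].
- exact: uniq_dom.
- exact: filter_uniq.
- by rewrite mem_filter; case: (boolP (k \in dom x)) => // /le_xd ->.
Qed.

Lemma fglift_is_linear (V : lmodType C) (F : K -> V) : linear (fglift F).
Proof.
move=> c x y; pose d := undup (dom x ++ dom y).
have d_uniq : uniq d by exact: undup_uniq.
have le_x : {subset dom x <= d}.
  by move=> k kx; rewrite mem_undup mem_cat kx.
have le_y : {subset dom y <= d}.
  by move=> k ky; rewrite mem_undup mem_cat ky orbT.
rewrite (fgliftEw F d_uniq le_x) (fgliftEw F d_uniq le_y) (@fgliftEw _ _ d) //.
  rewrite scaler_sumr -big_split /=; apply: eq_bigr => k _.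
  by rewrite coeffD coeffZ scalerDl scalerA.
move=> k /domD_subset; rewrite mem_cat => /orP[/domZ_subset /le_x|/le_y] //.
Qed.

HB.instance Definition _ (V : lmodType C) (F : K -> V) :=
  GRing.isLinear.Build C {freeg K / C} V _ (fglift F) (fglift_is_linear F).

Lemma fglift_eq (V : lmodType C) (F G : K -> V) x :
  F =1 G -> fglift F x = fglift G x.
Proof.
move=> FG; rewrite !(fgliftEw _ (uniq_dom x) (fun _ => id)).
by apply: eq_bigr => k _; rewrite FG.
Qed.

Lemma freegZ (c : C) (k : K) : << c *g k >> = c *: << k >> :> {freeg K / C}.
Proof. by apply/eqP/freeg_eqP => l; rewrite coeffZ !coeffU mul1r. Qed.

Lemma freeg_lin_ind (P : {freeg K / C} -> Prop) :
  P 0 -> (forall k, P << k >>) ->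
  (forall c x y, P x -> P y -> P (c *: x + y)) -> forall x, P x.
Proof.
move=> P0 PU PD x; rewrite -(freeg_sumE x).
by elim/big_rec: _ => // k y _ Py; rewrite freegZ; exact: PD.
Qed.

Lemma fglift_linear_r (U V : lmodType C) (F : K -> U -> V) x :
  (forall k c u v, F k (c *: u + v) = c *: F k u + F k v) ->
  linear (fun u => fglift (F^~ u) x).
Proof.
move=> linF c u v; rewrite !(fgliftEw _ (uniq_dom x) (fun _ => id)).
rewrite scaler_sumr -big_split /=; apply: eq_bigr => k _.
by rewrite linF scalerDr !scalerA [c * _]mulrC.
Qed.

Lemma freeg_lin_eq (V : lmodType C) (F G : {freeg K / C} -> V) :
  linear F -> linear G -> (forall k, F << k >> = G << k >>) -> F =1 G.
Proof.
move=> linF linG FG.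
by elim/freeg_lin_ind => [|//|c x y Fx Fy]; rewrite ?lin0 // linF linG Fx Fy.
Qed.

End LinearExtension.

Section Witt.
Context (C : fieldType) (n : nat).

Local Notation widx := ('rV[int]_n * 'I_n)%type.

(* The Witt algebra is free on the t^j \partial_i, encoded as << (j, i) >>;
   [witt_der] is its action by derivations on Laurent polynomials, which are
   free on the t^j, encoded as << j >> (see [witt_derD], [witt_der_mul] and
   [witt_der_br]). *)
Definition witt := {freeg widx / C}.

Definition laurent := {freeg 'rV[int]_n / C}.

Definition laurent_mul (f g : laurent) : laurent :=
  fglift (fun j : 'rV[int]_n => fglift (fun k : 'rV[int]_n => << j + k >> : laurent) g) f.

Definition witt_der (x : witt) (f : laurent) : laurent :=
  fglift (fun p : widx =>
    fglift (fun k : 'rV[int]_n => << (k 0 p.2)%:~R *g p.1 + k >> : laurent) f) x.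

(* [t^j \partial_i, t^k \partial_l]
   = k_i t^(j+k) \partial_l - j_l t^(j+k) \partial_i *)
Definition witt_br (x y : witt) : witt :=
  fglift (fun p : widx => fglift (fun q : widx =>
    << (q.1 0 p.2)%:~R *g (p.1 + q.1, q.2) >>
    - << (p.1 0 q.2)%:~R *g (p.1 + q.1, p.2) >> : witt) y) x.

Definition witt_D (u : 'rV[C]_n) (j : 'rV[int]_n) : witt :=
  \sum_(i < n) << u 0 i *g (j, i) >>.

Definition eps {A : pzSemiRingType} (i : 'I_n) : 'rV[A]_n := delta_mx 0 i.

Definition pairing (u : 'rV[C]_n) (j : 'rV[int]_n) : C :=
  \sum_(i < n) u 0 i * (j 0 i)%:~R.

(* The e_{ij}: [ord_max] is the index n+1, [fintype.lift ord_max i] the index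
   i <= n. *)
Definition witt_e (i j : 'I_n.+1) : witt :=
  match unlift ord_max i, unlift ord_max j with
  | Some i', Some j' => witt_D (eps j') (eps i' - eps j')
  | Some i', None    => - witt_D (const_mx 1) (eps i')
  | None,    Some j' => witt_D (eps j') (- eps j')
  | None,    None    => - witt_D (const_mx 1) 0
  end.

Definition sl (m : nat) : Type := {A : 'M[C]_m | \tr A == 0}.

(* A Lie algebra morphism by [sl_embed_br]; it sends the elementary matrices
   E_{ij}, i <> j, and the E_{ii} - E_{i+1,i+1} to the corresponding
   combinations of the e_{ij}. *)
Definition sl_embed (A : sl n.+1) : witt :=
  \sum_i \sum_j val A i j *: witt_e i j.

Definition omega_D (a : C) (lam : 'I_n -> C)
    (u : 'rV[C]_n) (j : 'rV[int]_n) (f : {mpoly C[n]}) : {mpoly C[n]} :=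
  (\prod_(i < n) lam i ^ j 0 i) *:
    ((\sum_(i < n) u 0 i *: 'X_i - (a * pairing u j)%:MP)
      * (f \mPo [tuple 'X_i - (j 0 i)%:~R%:MP | i < n])).

(* \Omega_{1-a}(\lambda_1, ..., \lambda_n); [omega_actD] is the formula for
   the action of a general D(u, j), and [omega_act_br] says that this is a
   module over the Witt algebra. *)
Definition omega_act (a : C) (lam : 'I_n -> C) (x : witt) (f : {mpoly C[n]}) :
    {mpoly C[n]} :=
  fglift (fun p : widx => omega_D a lam (eps p.2) p.1 f) x.

Definition omega_sl_act (a : C) (lam : 'I_n -> C) (A : sl n.+1) :
    {mpoly C[n]} -> {mpoly C[n]} :=
  omega_act a lam (sl_embed A).

Lemma sum_eps (V : lmodType C) (F : 'I_n -> V) (i : 'I_n) :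
  \sum_(l < n) (eps i : 'rV[C]_n) 0 l *: F l = F i.
Proof.
rewrite (bigD1 i) //= mxE !eqxx scale1r big1 ?addr0 // => l li.
by rewrite mxE eqxx (negbTE li) scale0r.
Qed.

Lemma pairing_eps i j : pairing (eps i) j = (j 0 i)%:~R.
Proof. exact: (@sum_eps C^o (fun l => (j 0 l)%:~R)). Qed.

Lemma pairing_linear j : linear (pairing^~ j : 'rV[C]_n -> C^o).
Proof.
move=> c u v; rewrite /pairing scaler_sumr -big_split /=; apply: eq_bigr => i _.
by rewrite !mxE mulrDl scalerAl.
Qed.

Lemma pairing_comb (c d : C) u v j :
  pairing (c *: u - d *: v) j = c * pairing u j - d * pairing v j.
Proof.
rewrite /pairing !mulr_sumr -sumrB; apply: eq_bigr => i _.
by rewrite !mxE mulrBl !mulrA.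
Qed.

Lemma pairingDr u j k : pairing u (j + k) = pairing u j + pairing u k.
Proof.
rewrite /pairing -big_split /=; apply: eq_bigr => i _.
by rewrite mxE rmorphD mulrDr.
Qed.

Lemma linear_eps (V : lmodType C) (F : 'rV[C]_n -> V) u :
  linear F -> F u = \sum_(i < n) u 0 i *: F (eps i).
Proof.
move=> linF; have F0 := lin0 linF.
rewrite {1}[u]row_sum_delta; elim/big_rec2: _ => // i x y _ <-.
exact: linF.
Qed.

Lemma witt_DE u j : witt_D u j = \sum_(i < n) u 0 i *: (<< (j, i) >> : witt).
Proof. by apply: eq_bigr => i _; exact: freegZ. Qed.

Lemma witt_D_linear j : linear (witt_D^~ j).
Proof.
move=> c u v; rewrite !witt_DE scaler_sumr -big_split /=; apply: eq_bigr => i _.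
by rewrite !mxE scalerDl scalerA.
Qed.

Lemma witt_D_eps i j : witt_D (eps i) j = << (j, i) >>.
Proof. by rewrite witt_DE sum_eps. Qed.

Lemma omega_D_linear a lam j f : linear (fun u => omega_D a lam u j f).
Proof.
move=> c u v; rewrite /omega_D scalerA [c * _]mulrC -scalerA -scalerDr; congr (_ *: _).
rewrite scalerAl -mulrDl; congr (_ * _).
rewrite scalerBr addrACA -opprD scaler_sumr -big_split /=; congr (_ - _).
  by apply: eq_bigr => i _; rewrite !mxE scalerDl scalerA.
rewrite [pairing _ _]pairing_linear mulrDr mpolyCD; congr (_ + _).
by rewrite -mul_mpolyC -mpolyCM mulrCA.
Qed.

Lemma omega_actD a lam u j f :
  omega_act a lam (witt_D u j) f = omega_D a lam u j f.
Proof.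
rewrite (linear_eps u (omega_D_linear a lam j f)) witt_DE /omega_act linear_sum.
apply: eq_bigr => i _; by rewrite linearZ /= liftU scale1r.
Qed.

Lemma witt_derD u j k :
  witt_der (witt_D u j) << k >> = << pairing u k *g j + k >>.
Proof.
rewrite witt_DE /witt_der linear_sum (freegZ (pairing _ _)) /pairing scaler_suml.
apply: eq_bigr => i _; rewrite linearZ /= liftU scale1r liftU scale1r /= (freegZ _%:~R).
by rewrite scalerA.
Qed.

Lemma witt_brUD p v k :
  witt_br << p >> (witt_D v k) =
  (k 0 p.2)%:~R *: witt_D v (p.1 + k)
  - pairing v p.1 *: (<< (p.1 + k, p.2) >> : witt).
Proof.
rewrite /witt_br liftU scale1r !witt_DE linear_sum /pairing scaler_suml scaler_sumr.
rewrite -sumrB; apply: eq_bigr => i _; rewrite linearZ /= liftU scale1r /=.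
by rewrite !(freegZ _%:~R) scalerBr !scalerA [in LHS]mulrC.
Qed.

Lemma witt_brD u j v k :
  witt_br (witt_D u j) (witt_D v k) =
  witt_D (pairing u k *: v - pairing v j *: u) (j + k).
Proof.
rewrite -scaleNr addrC witt_D_linear scaleNr addrC.
have -> : witt_D (pairing u k *: v) (j + k) = pairing u k *: witt_D v (j + k).
  rewrite !witt_DE scaler_sumr; apply: eq_bigr => i _; by rewrite mxE scalerA.
rewrite {1}[witt_D u j]witt_DE /witt_br linear_sum.
rewrite (witt_DE u) /pairing scaler_suml scaler_sumr -sumrB.
apply: eq_bigr => i _; rewrite linearZ /= -[fglift _ _]/(witt_br _ _) /= witt_brUD /=.
by rewrite scalerBr !scalerA [u 0 i * pairing _ _]mulrC.
Qed.

Let shift (j : 'rV[int]_n) : n.-tuple {mpoly C[n]} :=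
  [tuple 'X_i - (j 0 i)%:~R%:MP | i < n].
Let form (a : C) (u : 'rV[C]_n) (j : 'rV[int]_n) : {mpoly C[n]} :=
  \sum_(i < n) u 0 i *: 'X_i - (a * pairing u j)%:MP.

Lemma shift_shift j k (f : {mpoly C[n]}) :
  (f \mPo shift k) \mPo shift j = f \mPo shift (j + k).
Proof.
elim/mpolyind: f => [|c m f _ _ IH]; first by rewrite !comp_mpoly0.
rewrite !comp_mpolyD {}IH !comp_mpolyZ; congr (_ *: _ + _).
rewrite !comp_mpolyX rmorph_prod; apply: eq_bigr => i _.
rewrite rmorphXn !tnth_mktuple rmorphB /= comp_mpolyC; congr (_ ^+ _).
rewrite comp_mpolyXU -tnth_nth tnth_mktuple mxE rmorphD mpolyCD.
by rewrite opprD addrA.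
Qed.

Lemma form_shift a u j k :
  form a u k \mPo shift j = form a u k - (pairing u j)%:MP.
Proof.
rewrite rmorphB /= comp_mpolyC addrAC; congr (_ - _).
rewrite linear_sum /pairing [mpolyC _ _]rmorph_sum -sumrB; apply: eq_bigr => i _.
rewrite linearZ /= comp_mpolyXU -tnth_nth tnth_mktuple scalerBr.
by rewrite -mul_mpolyC -[in LHS]mul_mpolyC -mpolyCM mul_mpolyC.
Qed.

Lemma omega_D_comm a lam u j v k f : (forall i, lam i != 0) ->
  omega_D a lam u j (omega_D a lam v k f)
  - omega_D a lam v k (omega_D a lam u j f) =
  omega_D a lam (pairing u k *: v - pairing v j *: u) (j + k) f.
Proof.
move=> lam0.
have comp u' j' v' k' : omega_D a lam u' j' (omega_D a lam v' k' f) =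
    (\prod_(i < n) lam i ^ (j' + k') 0 i) *:
     (form a u' j' * (form a v' k' - (pairing v' j')%:MP) * (f \mPo shift (j' + k'))).
  rewrite /omega_D -!/(form _ _ _) -!/(shift _) comp_mpolyZ rmorphM /=.
  rewrite form_shift shift_shift -scalerAr scalerA mulrA; congr (_ *: _).
  by rewrite -big_split; apply: eq_bigr => i _; rewrite mxE expfzDr.
rewrite !comp [k + j]addrC -scalerBr -mulrBl; congr (_ *: (_ * _)).
rewrite -[RHS]/(form a _ (j + k)).
have -> : form a (pairing u k *: v - pairing v j *: u) (j + k) =
    (pairing u k)%:MP * (\sum_(i < n) v 0 i *: 'X_i)
    - (pairing v j)%:MP * (\sum_(i < n) u 0 i *: 'X_i)
    - (a * (pairing u k * pairing v k - pairing v j * pairing u j))%:MP.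
  rewrite /form; congr (_ - mpolyC _ _).
    rewrite !mul_mpolyC !scaler_sumr -sumrB; apply: eq_bigr => i _.
    by rewrite !mxE scalerBl !scalerA.
  by rewrite pairing_comb !pairingDr; ring.
rewrite /form !(mpolyCM, mpolyCB).
ring.
Qed.

Lemma witt_br_linear_l y : linear (witt_br^~ y).
Proof. by move=> c x x'; exact: linearP. Qed.

Lemma witt_br_linear_r x : linear (witt_br x).
Proof. by apply: fglift_linear_r => p c y y'; exact: linearP. Qed.

Lemma omega_D_linear_r a lam u j : linear (omega_D a lam u j).
Proof.
move=> c f g; rewrite /omega_D linearP /= mulrDr scalerDr -scalerAr.
by rewrite !scalerA mulrC.
Qed.

Lemma omega_act_linear_l a lam f : linear (fun x => omega_act a lam x f).
Proof. by move=> c x x'; exact: linearP. Qed.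

Lemma omega_act_linear_r a lam x : linear (omega_act a lam x).
Proof. by apply: fglift_linear_r => p; exact: omega_D_linear_r. Qed.

Lemma witt_der_linear_l f : linear (fun x => witt_der x f).
Proof. by move=> c x x'; exact: linearP. Qed.

Lemma witt_der_linear_r x : linear (witt_der x).
Proof. by apply: fglift_linear_r => p c f g; exact: linearP. Qed.

Let linear_comm (V : lmodType C) (act : witt -> V -> V) :
  (forall v, linear (act^~ v)) -> (forall x, linear (act x)) ->
  forall y v, linear (fun x => act x (act y v) - act y (act x v)).
Proof.
move=> linl linr y v c x x'; rewrite !linl linr scalerBr opprD.
by rewrite addrACA.
Qed.

Let rep_ext (V : lmodType C) (act : witt -> V -> V) :
  (forall v, linear (act^~ v)) -> (forall x, linear (act x)) ->
  (forall p q v, act (witt_br << p >> << q >>) v =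
     act << p >> (act << q >> v) - act << q >> (act << p >> v)) ->
  forall x y v, act (witt_br x y) v = act x (act y v) - act y (act x v).
Proof.
move=> linl linr ext x y v; move: x.
apply: freeg_lin_eq => [c x x'||p]; first by rewrite witt_br_linear_l linl.
  exact: linear_comm.
move: y; apply: freeg_lin_eq => [c y y'|c y y'|q]; last exact: ext.
  by rewrite witt_br_linear_r linl.
by rewrite -!(opprB (act _ (act << p >> v))) linear_comm // opprD scalerN.
Qed.

Lemma omega_act_br a lam x y f : (forall i, lam i != 0) ->
  omega_act a lam (witt_br x y) f =
  omega_act a lam x (omega_act a lam y f)
  - omega_act a lam y (omega_act a lam x f).
Proof.
move=> lam0; move: x y f; apply: rep_ext => [f|x|[j i] [k l] f].
- exact: omega_act_linear_l.
- exact: omega_act_linear_r.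
by rewrite -!witt_D_eps witt_brD !omega_actD omega_D_comm.
Qed.

Lemma witt_der_br x y f :
  witt_der (witt_br x y) f =
  witt_der x (witt_der y f) - witt_der y (witt_der x f).
Proof.
move: x y f; apply: rep_ext => [f|x|[j i] [k l]].
- exact: witt_der_linear_l.
- exact: witt_der_linear_r.
apply: freeg_lin_eq => [||m].
- exact: witt_der_linear_r.
- by move=> c f g; rewrite !witt_der_linear_r scalerBr opprD addrACA.
rewrite -!witt_D_eps witt_brD !witt_derD.
have derZ u j' c m' :
    witt_der (witt_D u j') << c *g m' >> = << c * pairing u m' *g j' + m' >>.
  have := witt_der_linear_r (witt_D u j') c << m' >> 0.
  have -> : witt_der (witt_D u j') 0 = 0.
    exact: lin0 (witt_der_linear_r _).
  rewrite !addr0 -freegZ witt_derD => ->.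
  by rewrite (freegZ (c * _)) (freegZ (pairing u _)) scalerA.
rewrite !derZ !addrA [k + j]addrC freegUB pairing_comb !pairingDr.
by congr << _ *g _ >>; ring.
Qed.

Lemma laurent_mul_linear_l g : linear (laurent_mul^~ g).
Proof. by move=> c f f'; exact: linearP. Qed.

Lemma laurent_mul_linear_r f : linear (laurent_mul f).
Proof. by apply: fglift_linear_r => k c g g'; exact: linearP. Qed.

Lemma witt_der_mul x f g :
  witt_der x (laurent_mul f g) =
  laurent_mul (witt_der x f) g + laurent_mul f (witt_der x g).
Proof.
move: x; apply: freeg_lin_eq => [|c x x'|[j i]]; first exact: witt_der_linear_l.
  rewrite !witt_der_linear_l laurent_mul_linear_l laurent_mul_linear_r.
  by rewrite scalerDr addrACA.
move: f; apply: freeg_lin_eq => [c f f'|c f f'|k].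
- by rewrite laurent_mul_linear_l witt_der_linear_r.
- rewrite witt_der_linear_r !laurent_mul_linear_l.
  by rewrite scalerDr addrACA.
move: g; apply: freeg_lin_eq => [c g g'|c g g'|m].
- by rewrite laurent_mul_linear_r witt_der_linear_r.
- rewrite witt_der_linear_r !laurent_mul_linear_r.
  by rewrite scalerDr addrACA.
rewrite /witt_der /laurent_mul !(liftU, scale1r) /= [k + (j + m)]addrCA -addrA.
by rewrite -scalerDl mxE rmorphD -freegZ.
Qed.

Let tau (i : 'I_n.+1) : 'rV[int]_n :=
  if unlift ord_max i is Some i' then eps i' else 0.
Let cov (i : 'I_n.+1) : 'rV[C]_n :=
  if unlift ord_max i is Some i' then eps i' else - const_mx 1.

Lemma witt_eE i j : witt_e i j = witt_D (cov j) (tau i - tau j).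
Proof.
have DN u k : witt_D (- u) k = - witt_D u k.
  by have := witt_D_linear k (-1) u 0; rewrite !addr0 !scaleN1r (lin0 (witt_D_linear k)) addr0.
rewrite /witt_e /cov /tau.
by do 2!case: unlift => [?|]; rewrite ?DN ?subr0 ?sub0r.
Qed.

Lemma pairing_cov i j :
  pairing (cov i) (tau j) = (i == j)%:R - (i == ord_max)%:R.
Proof.
have liftF (i' : 'I_n) : (fintype.lift ord_max i' == ord_max) = false.
  by rewrite eq_sym; apply/negbTE/neq_lift.
rewrite /cov /tau; case: unliftP => [i'|] ->; case: unliftP => [j'|] ->.
- by rewrite pairing_eps mxE eqxx (inj_eq lift_inj) liftF subr0 eq_sym; case: eqP.
- by rewrite pairing_eps mxE liftF subr0.
- rewrite [ord_max == _]eq_sym liftF eqxx sub0r /pairing (bigD1 j') //= big1.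
    by rewrite !mxE !eqxx mulr1 addr0.
  by move=> l lj; rewrite !mxE (negbTE lj) andbF mulr0n mulr0z mulr0.
- by rewrite subrr /pairing big1 // => l _; rewrite !mxE mulr0z mulr0.
Qed.

Lemma witt_e_br i j k l :
  witt_br (witt_e i j) (witt_e k l) =
  (j == k)%:R *: witt_e i l - (l == i)%:R *: witt_e k j.
Proof.
rewrite !witt_eE witt_brD.
have pairB u x y : pairing u (x - y) = pairing u x - pairing u y.
  by apply/eqP; rewrite eq_sym subr_eq -pairingDr subrK.
have subB (x y z : C) : x - z - (y - z) = x - y by ring.
rewrite !pairB !pairing_cov !subB.
have -> : ((j == k)%:R - (j == l)%:R) *: cov l - ((l == i)%:R - (l == j)%:R) *: cov j
    = (- (l == i)%:R) *: cov j + (j == k)%:R *: cov l.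
  rewrite !scalerBl scaleNr opprB [j == l]eq_sym; case: (l =P j) => [->|_].
    by rewrite addrA subrK addrC.
  by rewrite !scale0r subr0 sub0r addrC.
rewrite witt_D_linear scaleNr [RHS]addrC; congr (- _ + _).
  case: eqP => [->|_]; last by rewrite !scale0r.
  by congr (_ *: witt_D _ _); rewrite addrC addrA subrK.
have DZ c u x : witt_D (c *: u) x = c *: witt_D u x.
  by rewrite -[c *: u]addr0 witt_D_linear (lin0 (witt_D_linear x)) addr0.
rewrite DZ; case: eqP => [->|_]; last by rewrite !scale0r.
by congr (_ *: witt_D _ _); rewrite addrA subrK.
Qed.

Let gl_embed (M : 'M[C]_n.+1) : witt := \sum_i \sum_j M i j *: witt_e i j.

Let gl_embed_linear : linear gl_embed.
Proof.
move=> c M N; rewrite /gl_embed scaler_sumr -big_split; apply: eq_bigr => i _.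
rewrite scaler_sumr -big_split; apply: eq_bigr => j _.
by rewrite !mxE scalerDl scalerA.
Qed.

Let gl_embed_delta i j : gl_embed (delta_mx i j) = witt_e i j.
Proof.
rewrite /gl_embed (bigD1 i) //= (bigD1 j) //= mxE !eqxx scale1r.
rewrite !big1 ?addr0 // => [k ki|l lj].
  by rewrite big1 // => l _; rewrite mxE (negbTE ki) scale0r.
by rewrite mxE (negbTE lj) andbF scale0r.
Qed.

Let mx_lin_eq (V : lmodType C) (F G : 'M[C]_n.+1 -> V) :
  linear F -> linear G -> (forall i j, F (delta_mx i j) = G (delta_mx i j)) ->
  F =1 G.
Proof.
move=> linF linG FG M; rewrite [M]matrix_sum_delta pair_big /=.
elim/big_rec: _ => [|[i j] N _ FGN]; first by rewrite !lin0.
by rewrite linF linG FG FGN.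
Qed.

Let gl_embed_br A B :
  gl_embed (A *m B - B *m A) = witt_br (gl_embed A) (gl_embed B).
Proof.
move: A; apply: mx_lin_eq => [c A A'|c A A'|i j].
- rewrite -gl_embed_linear mulmxDl mulmxDr -scalemxAl -scalemxAr scalerBr opprD.
  by rewrite addrACA.
- by rewrite gl_embed_linear witt_br_linear_l.
move: B; apply: mx_lin_eq => [c B B'|c B B'|k l].
- rewrite -gl_embed_linear mulmxDl mulmxDr -scalemxAl -scalemxAr scalerBr opprD.
  by rewrite addrACA.
- by rewrite gl_embed_linear witt_br_linear_r.
rewrite !gl_embed_delta witt_e_br !mul_delta_mx_cond -!scaler_nat -scaleNr addrC.
have gZ c M : gl_embed (c *: M) = c *: gl_embed M.
  by rewrite -[c *: M]addr0 gl_embed_linear (lin0 gl_embed_linear) addr0.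
by rewrite gl_embed_linear gZ !gl_embed_delta scaleNr addrC.
Qed.

Lemma sl_embed_br (A B D : sl n.+1) :
  val D = val A *m val B - val B *m val A ->
  sl_embed D = witt_br (sl_embed A) (sl_embed B).
Proof. by move=> DE; rewrite -[sl_embed D]/(gl_embed _) DE gl_embed_br. Qed.

End Witt.

Section Irreducible.
Context (C : fieldType) (L : Type) (V : lmodType C) (act : L -> V -> V).

Definition submodule (S : V -> Prop) : Prop :=
  [/\ S 0, (forall (c : C) v w, S v -> S w -> S (c *: v + w))
    & forall x v, S v -> S (act x v)].

Definition irreducible_module : Prop :=
  (exists v : V, v <> 0) /\
  forall S : V -> Prop, submodule S ->
    (forall v, S v -> v = 0) \/ (forall v, S v).

End Irreducible.

(* Main.v *)
From HB Require Import structures.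
Require Import Defs.
From mathcomp Require Import all_boot all_order all_algebra.
From mathcomp Require Import mpoly complex boolp reals.
From mathcomp Require Import ring.
Import GRing.Theory.
Local Open Scope ring_scope.

(** The index [ord_max] stands for n+1; put t_(n+1) = 1.  With x_i = \partial_i, let Y_j = x_j + a for j <= n
   and Y_(n+1) = a - (x_1 + ... + x_n).  In these n+1 affine coordinates, which
   satisfy only the relation \sum_j Y_j = (n+1) a, the action becomes
   symmetric: for i != j, e_ij sends f, up to a nonzero scalar, to Y_j times
   the translate of f that adds 1 to Y_j and subtracts 1 from Y_i
   ([omega_root], [translate_coord]), and e_ii - e_jj multiplies f by Y_i - Y_j
   ([omega_coroot]).  Since \sum_j (Y_i - Y_j) = (n+1)(Y_i - a), a submodule is
   stable under multiplication by every Y_i, hence is an ideal of the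
   polynomial algebra ([submod_ideal]).

   Irreducibility.  Write y^(k) = y (y+1) ... (y+k-1).  If Y_j^(k) f lies in a
   submodule S, applying e_ij and subtracting a multiple of the same element
   shows that Y_j^(k+1) (f' - f) lies in S, where f' is the translate of f
   ([submod_difference]).  The difference f' - f has smaller degree, and when
   it vanishes for all i the polynomial f is periodic along a lattice of full
   rank, hence constant ([periodic_const]).  So, starting from a nonzero
   element of S, one finds for every j some k with Y_j^(k) in S
   ([submod_rising]).  Rising factorials modulo an ideal behave like powers: if
   z^(k) and w^(l) are in the ideal, so is (z+w)^(k+l) ([rising_ideal_add]).
   Summing over j, some ((n+1) a)^(N) is in S; this is a constant, and it is
   nonzero as soon as (n+1) a is not in {0, -1, -2, ...}.

   Reducibility.  If (n+1) a = -k, the polynomials vanishing at the points all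
   of whose coordinates Y_j are in {0, -1, -2, ...} form a submodule, because
   the factor Y_j kills the only translations that leave this set of points
   ([vanishing_submodule]).  The set is finite, since the coordinates sum to
   -k, and nonempty, so that the submodule is neither 0 nor everything
   ([vanishing_nontrivial]). *)

(** * Rising factorials modulo an ideal *)

Section RisingFactorial.
Context {A : comNzRingType}.
Implicit Types x z w : A.

Definition rising x (k : nat) : A := \prod_(r < k) (x + r%:R).

Lemma risingS x k : rising x k.+1 = x * rising (x + 1) k.
Proof.
rewrite /rising big_ord_recl addr0; congr (_ * _); apply: eq_bigr => r _.
by rewrite -addrA -natr1 [1 + _]addrC.
Qed.

Lemma risingSr x k : rising x k.+1 = rising x k * (x + k%:R).
Proof. by rewrite /rising big_ord_recr. Qed.

Lemma risingD x k l : rising x (k + l) = rising x k * rising (x + k%:R) l.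
Proof.
elim: l => [|l IHl]; first by rewrite addn0 /rising big_ord0 mulr1.
by rewrite addnS !risingSr IHl natrD -mulrA addrA.
Qed.

Context (I : A -> Prop).
Hypothesis I0 : I 0.
Hypothesis ID : forall x y, I x -> I y -> I (x + y).
Hypothesis IM : forall x y, I y -> I (x * y).

(** The identity
   z^(p) w^(q) (z + w + p + q) = z^(p+1) w^(q) + z^(p) w^(q+1)
   expands (z+w)^(k+l) into products z^(p) w^(q) with p + q = k + l, and then
   p >= k or q >= l. *)
Lemma rising_ideal_add z w k l :
  I (rising z k) -> I (rising w l) -> I (rising (z + w) (k + l)).
Proof.
move=> Iz Iw.
(* Induction on the number r of factors of (z+w)^(k+l) still to be expanded. *)
suff mixed r p q : (r + p + q = k + l)%N ->
    I (rising z p * rising w q * rising (z + w + (p + q)%:R) r).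
  have := mixed (k + l)%N 0%N 0%N (etrans (addn0 _) (addn0 _)).
  by rewrite addr0 {1 2}/rising !big_ord0 !mul1r.
elim: r p q => [|r IHr] p q pqr.
  rewrite add0n in pqr; rewrite [rising _ 0]big_ord0 mulr1.
  have [le_kp|/ltnW le_pk] := leqP k p.
    by rewrite -(subnKC le_kp) risingD -mulrA mulrC; apply: IM.
  have le_lq : (l <= q)%N by rewrite -(leq_add2l k) -pqr leq_add2r.
  by rewrite -(subnKC le_lq) risingD mulrA mulrAC; apply: IM.
have -> : rising z p * rising w q * rising (z + w + (p + q)%:R) r.+1 =
    rising z p.+1 * rising w q * rising (z + w + (p.+1 + q)%:R) r +
    rising z p * rising w q.+1 * rising (z + w + (p + q.+1)%:R) r.
  rewrite risingS !risingSr addSn addnS -[(p + q).+1%:R]natr1 addrA.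
  by rewrite natrD; ring.
by apply: ID; apply: IHr; rewrite ?addnS ?addSn -pqr ?addSn.
Qed.

Lemma rising_ideal_sum (J : Type) (s : seq J) (F : J -> A) :
  (forall j, exists k, I (rising (F j) k)) ->
  exists k, I (rising (\sum_(j <- s) F j) k).
Proof.
move=> IF; elim/big_ind: _ => [|x y [k Ix] [l Iy]|j _]; last exact: IF.
  by exists 1%N; rewrite risingS mul0r.
by exists (k + l)%N; apply: rising_ideal_add.
Qed.

End RisingFactorial.

Lemma rising_rmorph (A B : comNzRingType) (f : {rmorphism A -> B}) x k :
  f (rising x k) = rising (f x) k.
Proof.
by rewrite rmorph_prod; apply: eq_bigr => r _; rewrite rmorphD rmorph_nat.
Qed.

Lemma natr_inj {C : pzRingType} :
  (forall k : nat, (k%:R == 0 :> C) = (k == 0%N)) ->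
  injective (fun k : nat => k%:R : C).
Proof.
move=> char0 k l; wlog le_lk : k l / (l <= k)%N => [hwlog kl|].
  by have [le_lk|/ltnW le_kl] := leqP l k; [|symmetry]; apply: hwlog.
move/eqP; rewrite -subr_eq0 -natrB // char0 subn_eq0 => le_kl.
by apply/eqP; rewrite eqn_leq le_kl.
Qed.

(** * Translations of polynomials *)

Section Translation.
Context {C : fieldType} {n : nat}.
Implicit Types (f g : {mpoly C[n]}) (v : 'rV[int]_n).

Definition translate v f := f \mPo [tuple 'X_i - (v 0 i)%:~R%:MP | i < n].

HB.instance Definition _ v := GRing.RMorphism.copy (translate v) (translate v).
HB.instance Definition _ v := GRing.Linear.copy (translate v) (translate v).

Lemma translateC v c : translate v c%:MP = c%:MP.
Proof. exact: comp_mpolyC. Qed.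

Lemma translateU v i : translate v 'X_i = 'X_i - (v 0 i)%:~R%:MP.
Proof. by rewrite /translate comp_mpolyXU -tnth_nth tnth_mktuple. Qed.

Lemma translateD v v' f : translate v (translate v' f) = translate (v + v') f.
Proof. exact: shift_shift. Qed.

Lemma translate0 f : translate 0 f = f.
Proof.
rewrite -[RHS]comp_mpoly_id; congr (f \mPo _); apply: eq_from_tnth => i.
by rewrite !tnth_mktuple mxE subr0.
Qed.

Lemma translate_fixB v v' f :
  translate v f = f -> translate v' f = f -> translate (v - v') f = f.
Proof.
by move=> fv fv'; rewrite -{1}fv' translateD subrK.
Qed.

Lemma meval_translate v f p :
  (translate v f).@[p] = f.@[fun i => p i - (v 0 i)%:~R].
Proof.
rewrite comp_mpoly_meval; apply: meval_eq => i.
by rewrite tnth_mktuple mevalB mevalXU mevalC.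
Qed.

(** The successor stands on one side only because [msize] is the degree plus
   one: this bounds the degree of a product by the sum of the degrees. *)
Lemma msizeM_bound f g k l :
  (msize f <= k)%N -> (msize g <= l.+1)%N -> (msize (f * g) <= k + l)%N.
Proof.
have [-> _ _|f0] := eqVneq f 0; first by rewrite mul0r msize0.
have [-> _ _|g0 fk gl] := eqVneq g 0; first by rewrite mulr0 msize0.
by rewrite msizeM // -subn1 leq_subLR add1n -addnS leq_add.
Qed.

Lemma msizeD_bound f g k :
  (msize f <= k)%N -> (msize g <= k)%N -> (msize (f + g) <= k)%N.
Proof.
by move=> fk gk; apply: leq_trans (mmeasureD_le _ _ _) _; rewrite geq_max fk.
Qed.

(** That a translation preserves the leading part of a polynomial is
   multiplicative, so it is enough to check it on the variables. *)
Lemma msize_translateX v m : (msize (translate v 'X_[m] - 'X_[m]) <= mdeg m)%N.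
Proof.
pose lowers d f := (msize f <= d.+1)%N /\ (msize (translate v f - f) <= d)%N.
have lowersM d e f g : lowers d f -> lowers e g -> lowers (d + e)%N (f * g).
  move=> [fd vf] [ge vg]; split; first by rewrite -addSn msizeM_bound.
  have -> : translate v (f * g) - f * g =
      (translate v f - f) * translate v g + (translate v g - g) * f.
    by rewrite rmorphM /=; ring.
  apply: msizeD_bound; last by rewrite addnC; apply: msizeM_bound.
  apply: msizeM_bound => //; rewrite -(subrK g (translate v g)).
  by apply: msizeD_bound => //; apply: leqW.
suff [] : lowers (mdeg m) 'X_[m] by [].
have lowers1 : lowers 0%N 1.
  by split; rewrite ?msize1 // rmorph1 subrr msize0.
rewrite mpolyXE_id mdegE; elim/big_rec2: _ => // i d f _ ; apply: (lowersM).
elim: (m i) => [|e IHe] //; rewrite exprS -add1n; apply: (lowersM) => //; split.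
  by rewrite msizeX mdeg1.
by rewrite translateU addrC addKr mmeasureN mmeasureC; case: eqP.
Qed.

Lemma msize_translateB v f : (msize (translate v f - f) <= (msize f).-1)%N.
Proof.
rewrite {1 2}[f]mpolyE linear_sum -sumrB /=.
rewrite big_seq; elim/big_ind: _ => [|g h|m fm]; first by rewrite msize0.
  exact: msizeD_bound.
rewrite linearZ /= -scalerBr; apply: leq_trans (msizeZ_le _ _) _.
apply: leq_trans (msize_translateX _ _) _.
by have := msize_mdeg_lt fm; case: (msize f).
Qed.

(** Substitution of polynomials for the variables, indexed by a function rather
   than a tuple so that one variable at a time can be updated. *)
Definition peval (w : 'I_n -> {mpoly C[n]}) f := mmap (@mpolyC n C) w f.

HB.instance Definition _ w := GRing.RMorphism.copy (peval w) (mmap (@mpolyC n C) w).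

Lemma eq_peval w w' f : w =1 w' -> peval w f = peval w' f.
Proof.
by move=> ww'; apply: eq_bigr => m _; congr (_ * _); apply: mmap1_eq.
Qed.

Lemma peval_translate w v f :
  peval w (translate v f) = peval (fun i => w i - (v 0 i)%:~R) f.
Proof.
rewrite /translate comp_mpolyE rmorph_sum /=; apply: eq_bigr => m _.
rewrite -mul_mpolyC rmorphM /= [peval _ _%:MP]mmapC; congr (_ * _).
rewrite rmorph_prod; apply: eq_bigr => i _; rewrite rmorphXn /=; congr (_ ^+ _).
rewrite tnth_mktuple rmorphB /= [peval _ 'X_i]mmapX mmap1U.
by rewrite [peval _ _%:MP]mmapC /= rmorph_int.
Qed.

Hypothesis char0 : forall k : nat, (k%:R == 0 :> C) = (k == 0%N).

(** As a univariate polynomial in the value t of the i-th variable, [f] takes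
   the same value at w_i, w_i - 1, w_i - 2, ..., which are distinct in
   characteristic 0; so it does not depend on t. *)
Lemma peval_periodic f i w t :
  translate (eps i) f = f -> peval [eta w with i |-> t] f = peval w f.
Proof.
move=> fi.
pose g := mmap (@polyC _ \o @mpolyC n C) [eta polyC \o w with i |-> 'X] f.
have gE s : g.[s] = peval [eta w with i |-> s] f.
  rewrite /g /mmap horner_sum; apply: eq_bigr => m _.
  rewrite hornerM hornerC; congr (_ * _).
  rewrite /mmap1 horner_prod; apply: eq_bigr => l _; rewrite horner_exp /=.
  by case: eqP => _; rewrite ?hornerX ?hornerC.
have gN (k : nat) : g.[w i - k%:R] = peval w f.
  elim: k => [|k <-].
    by rewrite gE; apply: eq_peval => l /=; case: eqP => [->|]; rewrite ?subr0.
  rewrite !gE -[in RHS]fi peval_translate; apply: eq_peval => l /=.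
  by rewrite mxE eqxx; case: eqP => _; rewrite ?subr0 // -natr1 opprD addrA.
rewrite -gE; apply/eqP; rewrite -subr_eq0 -[peval w f](hornerC _ t) -hornerN.
rewrite -hornerD; suff -> : g - (peval w f)%:P = 0 by rewrite horner0.
set h := _ - _; apply/eqP; apply: contraT => h0.
pose rs := [seq w i - k%:R | k <- iota 0 (size h)].
suff : (size rs < size h)%N by rewrite size_map size_iota ltnn.
apply: max_poly_roots => //.
  by apply/allP => _ /mapP[k _ ->]; rewrite rootE hornerD hornerN hornerC gN subrr.
rewrite map_inj_uniq ?iota_uniq // => k l /addrI/oppr_inj.
by rewrite -!(rmorph_nat (@mpolyC n C)) => /(can_inj (@mpolyCK n C))/(natr_inj char0).
Qed.

(** By [peval_periodic] the variables can be set to 0 one after the other without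
   changing [f]. *)
Lemma periodic_const f :
  (forall i, translate (eps i) f = f) -> exists c, f = c%:MP.
Proof.
move=> per.
have pevalX : peval (fun i => 'X_i) f = f.
  rewrite -[RHS]comp_mpoly_id; apply: eq_peval => i.
  by rewrite tnth_mktuple.
have clear_coords (s : seq 'I_n) : peval (fun i => if i \in s then 0 else 'X_i) f = f.
  elim: s => [|i s IHs] //; rewrite -[RHS]IHs.
  rewrite -[RHS](peval_periodic _ i _ 0 (per i)); apply: eq_peval => l /=.
  by rewrite inE; case: eqP.
exists (\sum_(m <- msupp f) f@_m * \prod_(i < n) 0 ^+ m i).
rewrite -[LHS](clear_coords (enum 'I_n)) rmorph_sum; apply: eq_bigr => m _.
rewrite rmorphM rmorph_prod; congr (_ * _); apply: eq_bigr => i _.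
by rewrite mem_enum [RHS]rmorphXn rmorph0.
Qed.

End Translation.

(** * The action in symmetric coordinates *)

Section Action.
Context {C : fieldType} {n : nat} (a : C) (lam : 'I_n -> C).
Implicit Types (f g : {mpoly C[n]}) (i j l : 'I_n.+1).

(** With t_(n+1) = 1, every e_ij is t_i t_j^(-1) e_jj; [tau i] is the exponent
   of t_i, and [cov j] is the coefficient vector of the degree 0 derivation e_jj. *)
Definition tau i : 'rV[int]_n := if unlift ord_max i is Some i' then eps i' else 0.

Definition cov i : 'rV[C]_n :=
  if unlift ord_max i is Some i' then eps i' else - const_mx 1.

(** For i != j the term - a (u|j) of the action equals + a whatever i and j are;
   [coord] absorbs it. *)
Definition coord j : {mpoly C[n]} := \sum_(i < n) cov j 0 i *: 'X_i + a%:MP.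

Lemma pairing_cov_tauB i j l :
  pairing (cov l) (tau i - tau j) = (l == i)%:R - (l == j)%:R.
Proof.
apply/(addIr (pairing (cov l) (tau j))); rewrite -pairingDr subrK.
by rewrite !pairing_cov; ring.
Qed.

Lemma coord_lift (i : 'I_n) : coord (fintype.lift ord_max i) = 'X_i + a%:MP.
Proof. by rewrite /coord /cov liftK sum_eps. Qed.

Lemma coord_max : coord ord_max = - (\sum_(i < n) 'X_i) + a%:MP.
Proof.
rewrite /coord /cov unlift_none -sumrN; congr (_ + _); apply: eq_bigr => i _.
by rewrite !mxE scaleN1r.
Qed.

Lemma sum_coord : \sum_j coord j = (n.+1%:R * a)%:MP.
Proof.
rewrite (bigD1_ord ord_max) //= coord_max.
under eq_bigr do rewrite coord_lift.
rewrite big_split /= addrACA addNr add0r sumr_const card_ord -mulrS.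
by rewrite mulr_natl [RHS]raddfMn.
Qed.

Lemma translate_coord i j l :
  translate (tau i - tau j) (coord l) = coord l - ((l == i)%:R - (l == j)%:R)%:MP.
Proof.
have := form_shift 0 (cov l) (tau i - tau j) 0.
rewrite mul0r subr0 pairing_cov_tauB => formE.
by rewrite /coord rmorphD /= translateC [X in X + _]formE addrAC.
Qed.

Lemma omega_witt_e i j f :
  omega_act a lam (witt_e C i j) f =
  (\prod_(l < n) lam l ^ (tau i - tau j) 0 l) *:
    ((coord j - (a * (i == j)%:R)%:MP) * translate (tau i - tau j) f).
Proof.
rewrite witt_eE -/(tau i) -/(tau j) -/(cov j) omega_actD /omega_D.
congr (_ *: (_ * _)); rewrite pairing_cov_tauB eqxx [i == j]eq_sym /coord -addrA.
by congr (_ + _); rewrite -mpolyCN -[RHS]mpolyCB; congr (mpolyC _ _) => /=; ring.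
Qed.

Lemma omega_sl_actE (A : sl C n.+1) f :
  omega_sl_act a lam A f =
  \sum_i \sum_j val A i j *: omega_act a lam (witt_e C i j) f.
Proof.
rewrite /omega_sl_act /sl_embed /omega_act linear_sum; apply: eq_bigr => i _.
by rewrite linear_sum; apply: eq_bigr => j _; rewrite linearZ.
Qed.

Lemma trace_delta i j : i != j -> \tr (delta_mx i j : 'M[C]_n.+1) == 0.
Proof.
move=> ij; rewrite /mxtrace big1 // => l _; rewrite mxE.
by case: (l =P i) => [->|] //=; rewrite (negbTE ij).
Qed.

Definition root_sl {i j} (ij : i != j) : sl C n.+1 := 
  exist (fun A => is_true (\tr A == 0)) _ (trace_delta _ _ ij).

Lemma trace_coroot i j :
  \tr (delta_mx i i - delta_mx j j : 'M[C]_n.+1) == 0.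
Proof.
have tr_diag l : \tr (delta_mx l l : 'M[C]_n.+1) = 1.
  rewrite /mxtrace (bigD1 l) //= mxE !eqxx big1 ?addr0 // => k kl.
  by rewrite mxE (negbTE kl).
by rewrite raddfB /= !tr_diag subrr.
Qed.

Definition coroot_sl i j : sl C n.+1 := 
  exist (fun A => is_true (\tr A == 0)) _ (trace_coroot i j).

Lemma sum_delta_mx (V : lmodType C) (F : 'I_n.+1 -> 'I_n.+1 -> V) i j :
  \sum_k \sum_l (delta_mx i j : 'M[C]_n.+1) k l *: F k l = F i j.
Proof.
rewrite (bigD1 i) //= (bigD1 j) //= mxE !eqxx scale1r !big1 ?addr0 // => k ki.
  by rewrite big1 // => l _; rewrite mxE (negbTE ki) scale0r.
by rewrite mxE (negbTE ki) andbF scale0r.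
Qed.

Lemma omega_root i j (ij : i != j) f :
  omega_sl_act a lam (root_sl ij) f =
  (\prod_(l < n) lam l ^ (tau i - tau j) 0 l) *:
    (coord j * translate (tau i - tau j) f).
Proof.
rewrite omega_sl_actE /= sum_delta_mx omega_witt_e (negbTE ij).
by rewrite mulr0 subr0.
Qed.

Lemma omega_coroot i j f :
  omega_sl_act a lam (coroot_sl i j) f = (coord i - coord j) * f.
Proof.
have omega_diag l : omega_act a lam (witt_e C l l) f = (coord l - a%:MP) * f.
  rewrite omega_witt_e eqxx mulr1 subrr translate0 big1 ?scale1r // => k _.
  by rewrite mxE expr0z.
rewrite omega_sl_actE /=.
under eq_bigr => k _ do under eq_bigr => l _ do rewrite !mxE scalerBl.
under eq_bigr => k _ do rewrite sumrB.
rewrite sumrB; have dE u k l :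
    ((k == u) && (l == u))%:R = (delta_mx u u : 'M[C]_n.+1) k l by rewrite mxE.
under eq_bigr => k _ do under eq_bigr => l _ do rewrite dE.
rewrite sum_delta_mx.
under [X in _ - X]eq_bigr => k _ do under eq_bigr => l _ do rewrite dE.
by rewrite sum_delta_mx !omega_diag; ring.
Qed.

End Action.

(** * Irreducibility *)

Section Submodule.
Context {C : fieldType} {n : nat} (a : C) (lam : 'I_n -> C).
Hypothesis char0 : forall k : nat, (k%:R == 0 :> C) = (k == 0%N).
Hypothesis lam0 : forall i, lam i != 0.
Context (S : {mpoly C[n]} -> Prop).
Hypothesis subS : submodule (omega_sl_act a lam) S.
Local Notation Y := (coord a).
Implicit Types (f g : {mpoly C[n]}) (i j l : 'I_n.+1).

Lemma submod0 : S 0. Proof. by case: subS. Qed.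

Lemma submodZ c f : S f -> S (c *: f).
Proof. by case: subS => S0 SD _ Sf; rewrite -[_ *: _]addr0; apply: SD. Qed.

Lemma submodD f g : S f -> S g -> S (f + g).
Proof. by case: subS => S0 SD _ Sf Sg; rewrite -[f]scale1r; apply: SD. Qed.

Lemma submod_root i j f :
  i != j -> S f -> S (Y j * translate (tau i - tau j) f).
Proof.
move=> ij Sf; case: subS => _ _ /(_ (root_sl ij) _ Sf).
rewrite omega_root; set c := \prod_(l < n) _ => Sef.
have c0 : c != 0 by apply/prodf_neq0 => l _; apply: expfz_neq0.
by rewrite -[_ * _]scale1r -(mulVf c0) -scalerA; apply: submodZ.
Qed.

(** Averaging the operators Y_j - Y_i over i gives Y_j - a, because the Y_i sum
   to (n+1) a. *)
Lemma submod_coord j f : S f -> S (Y j * f).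
Proof.
move=> Sf.
have Sdiff i : S ((Y j - Y i) * f).
  by case: subS => _ _ /(_ (coroot_sl j i) _ Sf); rewrite omega_coroot.
have n1 : (n.+1%:R : C) != 0 by rewrite char0.
have -> : Y j * f = n.+1%:R^-1 *: (\sum_i (Y j - Y i) * f) + a *: f.
  rewrite -mulr_suml sumrB sum_coord sumr_const card_ord -[Y j *+ _]scaler_nat.
  rewrite mpolyCM mul_mpolyC -scalerBr -scalerAl scalerA mulVf // scale1r.
  by rewrite mulrBl mul_mpolyC subrK.
apply: submodD; apply: submodZ => //; elim/big_ind: _ => //.
  exact: submod0.
exact: submodD.
Qed.

Lemma submod_ideal g f : S f -> S (g * f).
Proof.
have SX (i : 'I_n) h : S h -> S ('X_i * h).
  move=> Sh; have := submod_coord (fintype.lift ord_max i) _ Sh.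
  move=> /submodD/(_ (submodZ (- a) _ Sh)).
  by rewrite coord_lift mulrDl mul_mpolyC scaleNr addrK.
move=> Sf; elim/mpolyind: g => [|c m g _ _ Sg].
  by rewrite mul0r; apply: submod0.
rewrite mulrDl; apply: submodD => //; rewrite -scalerAl; apply: submodZ.
rewrite mpolyXE_id; elim/big_rec: _ => [|i h _ Sh]; first by rewrite mul1r.
rewrite -mulrA; elim: (m i) => [|k IHk]; first by rewrite mul1r.
by rewrite exprS -mulrA; apply: SX.
Qed.

(** e_ij turns Y_j^(k) into Y_j (Y_j+1)^(k) = Y_j^(k+1), and Y_j^(k+1) f is in [S]
   since [S] is an ideal. *)
Lemma submod_difference i j k f : i != j ->
  S (rising (Y j) k * f) ->
  S (rising (Y j) k.+1 * (translate (tau i - tau j) f - f)).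
Proof.
move=> ij Sf; rewrite mulrBr; apply: submodD.
  have := submod_root _ _ _ ij Sf; rewrite rmorphM /= rising_rmorph /=.
  rewrite translate_coord eqxx eq_sym (negbTE ij) sub0r mpolyCN opprK.
  by rewrite mpolyC1 mulrA -risingS.
rewrite -scaleN1r; apply: submodZ; rewrite risingSr mulrAC mulrC.
exact: submod_ideal.
Qed.

(** Taking differences lowers the degree until a polynomial fixed by all the
   translations tau_i - tau_j is reached.  These generate the lattice Z^n, so
   that polynomial is a nonzero constant. *)
Lemma submod_rising f j : S f -> f != 0 -> exists k, S (rising (Y j) k).
Proof.
move=> Sf f0.
suff descent s g k : (msize g <= s)%N -> g != 0 -> S (rising (Y j) k * g) ->
    exists k, S (rising (Y j) k).
  by apply: (descent _ f 0%N (leqnn _)) => //; rewrite /rising big_ord0 mul1r.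
elim: s g k => [|s IHs] g k gs g0 Sg.
  by move: g0; rewrite -msize_poly_eq0 -leqn0 gs.
case: (pickP (fun i => translate (tau i - tau j) g != g)) => [i gi|fixed].
  have ij : i != j by apply: contraNneq gi => ->; rewrite subrr translate0.
  apply: (IHs _ k.+1 _ _ (submod_difference _ _ _ _ ij Sg)).
    apply: leq_trans (msize_translateB _ _) _.
    by rewrite -ltnS prednK // lt0n msize_poly_eq0.
  by rewrite subr_eq0.
have [i|c gE] := periodic_const char0 g.
  have fix_tau l : translate (tau l - tau j) g = g by apply/eqP/negbFE/fixed.
  have := translate_fixB _ _ _ (fix_tau (fintype.lift ord_max i)) (fix_tau ord_max).
  by rewrite opprB addrA subrK /tau liftK unlift_none subr0.
exists k; rewrite gE in g0 Sg; rewrite mpolyC_eq0 in g0.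
have := submod_ideal (c^-1)%:MP _ Sg.
by rewrite mulrCA -mpolyCM mulVf // mulr1.
Qed.

Lemma submod_full f :
  S f -> f != 0 -> ~ (exists k : nat, a = - (n.+1%:R)^-1 * k%:R) ->
  forall g, S g.
Proof.
move=> Sf f0 a_notin g.
have [N SN] : exists N, S (rising (n.+1%:R * a)%:MP N).
  rewrite -sum_coord; apply: rising_ideal_sum; first exact: submod0.
  - exact: submodD.
  - exact: submod_ideal.
  by move=> j; apply: submod_rising Sf f0.
rewrite -rising_rmorph /= in SN; set c := rising _ N in SN.
suff c0 : c != 0.
  have := submod_ideal (g * (c^-1)%:MP) _ SN.
  by rewrite -mulrA -mpolyCM mulVf // mulr1.
apply/prodf_neq0 => r _; apply: contra_notN a_notin; rewrite addr_eq0 => /eqP aE.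
exists r; have n1 : (n.+1%:R : C) != 0 by rewrite char0.
by rewrite mulNr -mulrN -aE mulKf.
Qed.

End Submodule.

(** * Reducibility *)

Section VanishingIdeal.
Context {C : fieldType} {n : nat} (a : C) (lam : 'I_n -> C).
Hypothesis char0 : forall k : nat, (k%:R == 0 :> C) = (k == 0%N).
Local Notation Y := (coord a).
Implicit Types (f g : {mpoly C[n]}) (i j l : 'I_n.+1) (p : 'I_n -> C).

(** When (n+1) a = - k the coordinates of these points are the weights of the k-th
   symmetric power of the dual of the standard representation: the functions on
   them form the finite-dimensional quotient of the module. *)
Definition weight_point p := exists r : 'I_n.+1 -> nat, forall j, (Y j).@[p] = - (r j)%:R.

Definition vanishing f := forall p, weight_point p -> f.@[p] = 0.

(** Evaluating e_ij f at a point gives Y_j times the value of [f] at the point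
   where Y_j is increased by 1 and Y_i decreased by 1.  This point leaves the set
   only if Y_j = 0. *)
Lemma vanishing_submodule : submodule (omega_sl_act a lam) vanishing.
Proof.
split=> [p _|c f g vf vg p wp|A f vf p wp]; first exact: meval0.
  by rewrite mevalD mevalZ vf // vg // mulr0 addr0.
rewrite omega_sl_actE raddf_sum big1 // => i _; rewrite raddf_sum big1 // => j _.
rewrite /= mevalZ omega_witt_e mevalZ mevalM.
suff -> : (Y j - (a * (i == j)%:R)%:MP).@[p] * (translate (tau i - tau j) f).@[p] = 0.
  by rewrite !mulr0.
have [->|ij] := eqVneq i j.
  by rewrite subrr translate0 (vf _ wp) mulr0.
rewrite mulr0 subr0; case: (wp) => r rE.
have [rj|rj] := posnP (r j); first by rewrite rE rj oppr0 mul0r.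
rewrite meval_translate vf ?mulr0 //.
exists (fun l => (r l + (l == i) - (l == j))%N) => l.
rewrite -meval_translate translate_coord mevalB rE mevalC.
have [->|lj] := eqVneq l j.
  by rewrite [j == i]eq_sym (negbTE ij) addn0 natrB //=; ring.
by rewrite subn0 natrD /=; ring.
Qed.


Lemma weight_point_sum k p (r : 'I_n.+1 -> nat) :
  n.+1%:R * a = - k%:R -> (forall j, (Y j).@[p] = - (r j)%:R) ->
  (\sum_j r j = k)%N.
Proof.
move=> ak rE; apply: (natr_inj char0); apply: oppr_inj => /=.
rewrite -ak -[RHS](mevalC p) -(sum_coord a) [RHS]raddf_sum natr_sum -sumrN.
by apply: eq_bigr => j _; rewrite -rE.
Qed.

(** The coordinates of the points are between - k and 0, so Y_j^(k+1) vanishes at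
   all of them for any j; and the point with coordinates 0, ..., 0, - k keeps 1
   out of the submodule. *)
Lemma vanishing_nontrivial (i0 : 'I_n) k : n.+1%:R * a = - k%:R ->
  ~ ((forall f, vanishing f -> f = 0) \/ (forall f, vanishing f)).
Proof.
move=> ak [trivial|full].
  have meval_rising p j : (rising (Y j) k.+1).@[p] = rising (Y j).@[p] k.+1.
    exact: rising_rmorph.
  pose j0 := fintype.lift ord_max i0.
  have h0 : rising (Y j0) k.+1 = 0.
    apply: trivial => p [r rE]; rewrite meval_rising rE.
    have rk : (r j0 < k.+1)%N.
      by rewrite ltnS -(weight_point_sum k p r ak rE) (bigD1 j0) //= leq_addr.
    by rewrite /rising (bigD1 (Ordinal rk)) //= addNr mul0r.
  (* Here Y_j = 1, and 1^(k+1) = (k+1)! is not 0. *)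
  have /eqP := congr1 (meval (fun=> 1 - a)) h0.
  rewrite meval0 meval_rising coord_lift mevalD mevalXU mevalC subrK.
  by apply/negP/prodf_neq0 => m _; rewrite addrC natr1 char0.
have /eqP : (1 : {mpoly C[n]}).@[fun=> - a] = 0.
  apply: full; exists (fun j => if j == ord_max then k else 0%N) => j.
  case: (unliftP ord_max j) => [i|] ->.
    rewrite coord_lift mevalD mevalXU mevalC addNr.
    by rewrite eq_sym (negbTE (neq_lift _ _)) oppr0.
  rewrite coord_max eqxx mevalD mevalN mevalC (raddf_sum (meval _)) /=.
  rewrite (eq_bigr (fun=> - a)) => [|i _]; last exact: mevalXU.
  by rewrite sumr_const card_ord mulNrn opprK -mulrSr -[LHS]mulr_natl ak.
by rewrite meval1 oner_eq0.
Qed.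

End VanishingIdeal.

Theorem corollary17 (R : realType) (n : nat) (a : R[i]%C) (lam : 'I_n -> R[i]%C)
    (hn : (2 <= n)%N) (hlam : forall i, lam i != 0) :
  irreducible_module (omega_sl_act a lam) <->
  ~ (exists k : nat, a = - (n.+1%:R)^-1 * k%:R).
Proof.
have char0 (k : nat) : (k%:R == 0 :> R[i]%C) = (k == 0%N) by exact: Num.Theory.pnatr_eq0.
split=> [[_ irr] [k ak]|a_notin].
  apply: (vanishing_nontrivial a char0 (Ordinal (ltnW hn)) k).
    by rewrite ak mulNr mulrN mulVKf // char0.
  exact/irr/vanishing_submodule.
split; first by exists 1; apply/eqP/oner_neq0.
move=> S subS.
have [[f [Sf /eqP f0]]|noS] := EM (exists f, S f /\ f <> 0).
  by right; apply: (submod_full a lam char0 hlam S subS f).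
by left=> f Sf; apply: contrapT => f0; apply: noS; exists f.
Qed.
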